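(* Let $n\ge2$. The set $\mathcal{P}$ of virtual line elements spans $K(I\mathbb{P}(1,n))_{\mathbb{C}}$ as a complex vector space.
   Context: Fix $n\ge2$, $\zeta=\exp(2\pi i/n)$, $G=\mathbb{C}^*$. Let $X=\mathbb{C}^2\setminus\{(0,0)\}$ with the action $\lambda\cdot(z_1,z_2)=(\lambda z_1,\lambda^n z_2)$; $\mathbb{P}(1,n)=[X/G]$. The inertia manifold is $I_GX=\coprod_{m\in\mathbb{Z}/n\mathbb{Z}}X^m$, with $X^m$ the fixed locus of $\zeta^m$, and $K(I\mathbb{P}(1,n))_{\mathbb{C}}=K_G(I_GX)\otimes\mathbb{C}$. As a vector space it is $\bigoplus_{m=0}^{n-1}A_m$ with $$A_0=\frac{\mathbb{C}[x_0^{\pm1}]}{\langle (x_0-1)(x_0^n-1)\rangle},\qquad A_m=\frac{\mathbb{C}[x_m^{\pm1}]}{\langle x_m^n-1\rangle}\quad(1\le m\le n-1).$$ The virtual product $*$ is the $\mathbb{C}$-bilinear product with, for $a_1,a_2\in\mathbb{Z}$ and $m_1,m_2\in\{0,\dots,n-1\}$ (index $m_1+m_2$ taken mod $n$), $$x_{m_1}^{a_1}*x_{m_2}^{a_2}=x_{m_1+m_2}^{a_1+a_2}\cdot e(m_1,m_2),$$ where the product on the right is the ordinary one in $A_{m_1+m_2}$ and $e(m_1,m_2)=1$ if $m_1=0$ or $m_2=0$; $e(m_1,m_2)=(1-x_0^{-1})^2$ if $m_1,m_2\ne0$ and $m_1+m_2=n$; $e(m_1,m_2)=1-x_{m_1+m_2}^{-1}$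 otherwise. The identity for $*$ is the identity of $A_0$. The virtual Adams operations are the $\mathbb{C}$-linear maps $\widetilde\psi^k$ ($k\ge1$) with $\widetilde\psi^k(x_0^a)=x_0^{ka}$ and $\widetilde\psi^k(x_m^a)=x_m^{ka}\cdot\sum_{i=0}^{k-1}x_m^{-i}$ (ordinary product) for $m\ne0$. A virtual line element is a $*$-invertible element $\mathscr{L}\in K(I\mathbb{P}(1,n))_{\mathbb{C}}$ with $\widetilde\psi^k(\mathscr{L})=\mathscr{L}^{*k}$ for all $k\ge1$. *)

(* Defs.v *)
From HB Require Import structures.
From mathcomp Require Import all_boot all_order all_algebra.
From mathcomp Require Import reals complex.

Set Implicit Arguments.
Unset Strict Implicit.
Unset Printing Implicit Defensive.

Import GRing.Theory.
Local Open Scope ring_scope.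

Section VirtualKTheory.

Variables (F : fieldType) (n : nat).

Definition sector_rel (m : 'I_n) : {poly F} :=
  if m == 0%N :> nat then ('X - 1) * ('X^n - 1) else 'X^n - 1.

(* F[x_m, x_m^-1] / <sector_rel m>.  The generator is already invertible in
   F[x_m] / <sector_rel m> (lemma [sector_unitX]), so the library quotient
   {poly %/ _} is the quotient of the Laurent polynomial ring (lemma
   [sector_universal]).  In it x_m is 'qX, and x_m ^ a makes sense for a : int.
   The library replaces a non-monic or constant modulus by 'X; this does not
   happen here when 0 < n, see [mk_monic_sector_rel]. *)
Definition sector (m : 'I_n) := {poly %/ sector_rel m}.

Definition inertiaK := {dffun forall m : 'I_n, sector m}.

HB.instance Definition _ := Choice.on inertiaK.

Definition inertiaK_zero : inertiaK := [ffun m : 'I_n => (0 : sector m)].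
Definition inertiaK_opp (f : inertiaK) : inertiaK :=
  [ffun m : 'I_n => (- f m : sector m)].
Definition inertiaK_add (f g : inertiaK) : inertiaK :=
  [ffun m : 'I_n => (f m + g m : sector m)].
Definition inertiaK_scale (c : F) (f : inertiaK) : inertiaK :=
  [ffun m : 'I_n => (c *: f m : sector m)].

Fact inertiaK_addA : associative inertiaK_add.
Proof. by move=> f g h; apply/ffunP=> m; rewrite !ffunE addrA. Qed.
Fact inertiaK_addC : commutative inertiaK_add.
Proof. by move=> f g; apply/ffunP=> m; rewrite !ffunE addrC. Qed.
Fact inertiaK_add0 : left_id inertiaK_zero inertiaK_add.
Proof. by move=> f; apply/ffunP=> m; rewrite !ffunE add0r. Qed.
Fact inertiaK_addN : left_inverse inertiaK_zero inertiaK_opp inertiaK_add.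
Proof. by move=> f; apply/ffunP=> m; rewrite !ffunE addNr. Qed.

HB.instance Definition _ := GRing.isZmodule.Build inertiaK
  inertiaK_addA inertiaK_addC inertiaK_add0 inertiaK_addN.

Fact inertiaK_scaleA a b f :
  inertiaK_scale a (inertiaK_scale b f) = inertiaK_scale (a * b) f.
Proof. by apply/ffunP=> m; rewrite !ffunE scalerA. Qed.
Fact inertiaK_scale1 : left_id 1 inertiaK_scale.
Proof. by move=> f; apply/ffunP=> m; rewrite !ffunE scale1r. Qed.
Fact inertiaK_scaleDr : right_distributive inertiaK_scale +%R.
Proof. by move=> a f g; apply/ffunP=> m; rewrite !ffunE scalerDr. Qed.
Fact inertiaK_scaleDl f : {morph inertiaK_scale^~ f : a b / a + b}.
Proof. by move=> a b; apply/ffunP=> m; rewrite !ffunE scalerDl. Qed.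

HB.instance Definition _ := GRing.Zmodule_isLmodule.Build F inertiaK
  inertiaK_scaleA inertiaK_scale1 inertiaK_scaleDr inertiaK_scaleDl.

(* The element x_m ^ a of the summand indexed by m. *)
Definition xmon (m : 'I_n) (a : int) : inertiaK :=
  [ffun m' : 'I_n => (if m' == m then ('qX : sector m') ^ a else 0 : sector m')].

(* e(m1, m2) as an element of the sector m; it is only used for m congruent to
   m1 + m2 modulo n. *)
Definition obstruction (m1 m2 m : 'I_n) : sector m :=
  if (m1 == 0%N :> nat) || (m2 == 0%N :> nat) then 1
  else if (m1 + m2 == n)%N then (1 - ('qX : sector m)^-1) ^+ 2
  else 1 - ('qX : sector m)^-1.

(* The bilinear product with x_m1 ^ a1 * x_m2 ^ a2 = x_m ^ (a1 + a2) e(m1, m2),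
   m = m1 + m2 mod n.  It is written on the canonical polynomial representatives
   of the components, reduced in the target sector; [vmul_xmon] recovers the
   formula for all a1, a2 : int. *)
Definition vmul (f g : inertiaK) : inertiaK :=
  [ffun m : 'I_n =>
    (\sum_(m1 < n) \sum_(m2 < n | ((m1 + m2) %% n == m)%N)
       in_qpoly (sector_rel m) ((f m1 : {poly F}) * (g m2 : {poly F}))
       * obstruction m1 m2 m : sector m)].

Definition vone : inertiaK :=
  [ffun m : 'I_n => (if m == 0%N :> nat then 1 else 0 : sector m)].

Definition vexp (f : inertiaK) (k : nat) : inertiaK := iter k (vmul f) vone.

(* psi^k (x_m ^ a) = x_m ^ (k a) * \sum_(i < k) x_m ^ - i for m <> 0, without the
   sum for m = 0.  Again on polynomial representatives, where x ^ a |-> x ^ (k a)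
   is composition with 'X^k; see [vadams_xmon]. *)
Definition vadams (k : nat) (f : inertiaK) : inertiaK :=
  [ffun m : 'I_n =>
    (in_qpoly (sector_rel m) ((f m : {poly F}) \Po 'X^k)
     * (if m == 0%N :> nat then 1
        else \sum_(i < k) ('qX : sector m) ^- i) : sector m)].

Definition vinvertible (f : inertiaK) : Prop :=
  exists g : inertiaK, vmul f g = vone /\ vmul g f = vone.

Definition virtual_line_element (L : inertiaK) : Prop :=
  vinvertible L /\ forall k : nat, (1 <= k)%N -> vadams k L = vexp L k.

End VirtualKTheory.

(* By [xmon_gen], the values on Laurent monomials given by [vmul_xmon] and
   [vadams_xmon] determine the bilinear map vmul and the linear map vadams k. *)

Section VirtualKTheoryCheck.

Variables (F : fieldType) (n : nat).
Hypothesis n_gt0 : (0 < n)%N.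
Implicit Types (m : 'I_n) (f g h : inertiaK F n).

Lemma sector_rel_monic m : sector_rel F m \is monic.
Proof.
have mn : ('X^n - 1 : {poly F}) \is monic by rewrite monic_Xn_sub_1.
by rewrite /sector_rel; case: ifP => _ //; rewrite monicMl ?monicXsubC.
Qed.

Lemma mk_monic_sector_rel m : mk_monic (sector_rel F m) = sector_rel F m.
Proof.
rewrite /mk_monic sector_rel_monic andbT ifT // /sector_rel.
have sn : size ('X^n - 1 : {poly F}) = n.+1 by rewrite size_Xn_sub_1.
case: ifP => _; last by rewrite sn ltnS.
rewrite size_monicM ?monicXsubC ?size_XsubC ?sn //.
by rewrite -size_poly_gt0 sn.
Qed.

Lemma in_qpoly_eq0 m (p : {poly F}) :
  (in_qpoly (sector_rel F m) p == 0) = (sector_rel F m %| p).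
Proof.
rewrite -val_eqE /= mk_monic_sector_rel.
by rewrite -Pdiv.IdomainMonic.modpE ?sector_rel_monic // /dvdp.
Qed.

Lemma in_qpolyK m (p : sector F m) : in_qpoly (sector_rel F m) p = p.
Proof. by apply/val_inj/in_qpoly_small/size_mk_monic. Qed.

Lemma dvd_sub_in_qpoly m (p : {poly F}) :
  sector_rel F m %| p - (in_qpoly (sector_rel F m) p : {poly F}).
Proof.
rewrite /= mk_monic_sector_rel -Pdiv.IdomainMonic.modpE ?sector_rel_monic //.
by rewrite {1}(divp_eq p (sector_rel F m)) addrK dvdp_mull.
Qed.

Lemma sector_relE m :
  sector_rel F m =
  (if m == 0%N :> nat then 'X - 1 else 1) * ('X^n - 1).
Proof. by rewrite /sector_rel; case: ifP => // _; rewrite mul1r. Qed.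

Lemma sector_rel_dvd m : ('X^n - 1 : {poly F}) %| sector_rel F m.
Proof. by rewrite sector_relE dvdp_mull. Qed.

Lemma sector_unitX m : ('qX : sector F m) \is a GRing.unit.
Proof.
rewrite qualifE /= mk_monic_sector_rel.
rewrite -Pdiv.IdomainMonic.modpE ?sector_rel_monic // coprimep_modr.
rewrite coprimepX /root sector_relE hornerM mulf_eq0 negb_or.
apply/andP; split; first by case: ifP => _; rewrite !hornerE ?oppr_eq0 oner_neq0.
by rewrite !hornerE expr0n gtn_eqF //= sub0r oppr_eq0 oner_neq0.
Qed.

Lemma sector_universal m (B : comAlgType F) (u : B) :
    horner_alg u (sector_rel F m) = 0 ->
  (exists phi : {lrmorphism sector F m -> B}, phi 'qX = u) /\
  (forall phi psi : {lrmorphism sector F m -> B},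
     phi 'qX = psi 'qX -> phi =1 psi).
Proof.
move=> relu; have evalE (p : {poly F}) :
    horner_alg u (in_qpoly (sector_rel F m) p : {poly F}) = horner_alg u p.
  apply/eqP; rewrite eq_sym -subr_eq0 -rmorphB /=.
  by have /dvdpP[q ->] := dvd_sub_in_qpoly m p; rewrite rmorphM /= relu mulr0.
split.
  pose f (p : sector F m) := horner_alg u (p : {poly F}).
  have f_lin : linear f.
    move=> c p q; transitivity (horner_alg u (c *: (p : {poly F})) + f q).
      exact: (rmorphD (horner_alg u)).
    by congr (_ + _); rewrite /f -mul_polyC rmorphM /= horner_algC mulr_algl.
  have f_mul : monoid_morphism f.
    split; first by rewrite /f /= rmorph1.
    by move=> p q; rewrite /f evalE rmorphM.
  pose phi : {lrmorphism sector F m -> B} :=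
    HB.pack f (GRing.isLinear.Build _ _ _ _ f f_lin)
              (GRing.isMonoidMorphism.Build _ _ f f_mul).
  exists phi; rewrite -[LHS]/(f _) /f evalE. exact: horner_algX.
move=> phi psi eqX p; rewrite -[p]in_qpolyK.
elim/poly_ind: (p : {poly F}) => [|q c IH]; first by rewrite !linear0.
rewrite rmorphD rmorphM /= !rmorphD !rmorphM /= IH eqX; congr (_ + _).
by rewrite -alg_polyC !(linearZ, rmorph1).
Qed.

Lemma obstructionC m1 m2 m : obstruction F m1 m2 m = obstruction F m2 m1 m.
Proof. by rewrite /obstruction orbC addnC. Qed.

Lemma obstruction_kill m1 m2 m (p : {poly F}) :
    ((m1 + m2) %% n)%N = m -> sector_rel F m1 %| p ->
  in_qpoly (sector_rel F m) p * obstruction F m1 m2 m = 0.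
Proof.
move=> m12 p_rel.
have [rel_m|] := boolP (sector_rel F m %| sector_rel F m1).
  have /eqP-> : in_qpoly (sector_rel F m) p == 0.
    by rewrite in_qpoly_eq0 (dvdp_trans rel_m).
  by rewrite mul0r.
move=> /negP not_dvd.
have [m1_0|m1_0] := eqVneq (m1 : nat) 0%N.
  case: not_dvd; rewrite !sector_relE m1_0 /=.
  by case: ifP => _; rewrite ?dvdpp // mul1r dvdp_mull.
have [m0|m0] := eqVneq (m : nat) 0%N; last first.
  by case: not_dvd; rewrite !sector_relE !ifN // dvdpp.
have m12n : (m1 + m2)%N = n.
  have /dvdnP[[|[|k]] e] : (n %| m1 + m2)%N by rewrite /dvdn m12 m0.
  - by move: e m1_0; rewrite mul0n => /eqP; rewrite addn_eq0 => /andP[->].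
  - by rewrite e mul1n.
  - have : (m1 + m2 < n + n)%N by rewrite -addnS leq_add // ltnW.
    by rewrite e addnn -mul2n ltn_mul2r ltnS ltnS ltn0 andbF.
have m2_0 : (m2 : nat) != 0%N.
  by apply/eqP=> m2_0; have := ltn_ord m1; rewrite -[X in (_ < X)%N]m12n m2_0 addn0 ltnn.
rewrite /obstruction (negbTE m1_0) (negbTE m2_0) m12n eqxx /=.
have -> : 1 - ('qX : sector F m)^-1 =
          in_qpoly (sector_rel F m) ('X - 1) * ('qX : sector F m)^-1.
  rewrite rmorphB rmorph1 mulrBl mul1r divrr //; exact: sector_unitX.
have /eqP : in_qpoly (sector_rel F m) (p * ('X - 1)) == 0.
  rewrite in_qpoly_eq0 sector_relE m0 /= mulrC dvdp_mul //.
  by apply: dvdp_trans p_rel; apply: sector_rel_dvd.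
rewrite rmorphM /= => pX0.
by rewrite expr2 !mulrA pX0 !mul0r.
Qed.

Lemma obstruction_mod m1 m2 m (p : {poly F}) :
    ((m1 + m2) %% n)%N = m ->
  in_qpoly (sector_rel F m) (in_qpoly (sector_rel F m1) p) * obstruction F m1 m2 m
  = in_qpoly (sector_rel F m) p * obstruction F m1 m2 m.
Proof.
move=> m12; apply/eqP; rewrite eq_sym -subr_eq0 -mulrBl -rmorphB /=.
by rewrite obstruction_kill // dvd_sub_in_qpoly.
Qed.

Lemma obstruction_expX m1 m2 m (a : int) :
    ((m1 + m2) %% n)%N = m ->
  in_qpoly (sector_rel F m) (('qX : sector F m1) ^ a) * obstruction F m1 m2 m
  = ('qX : sector F m) ^ a * obstruction F m1 m2 m.
Proof.
move=> m12; set e := obstruction F m1 m2 m.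
pose t (p : sector F m1) : sector F m := in_qpoly (sector_rel F m) p.
have tM p q : t (p * q) * e = t p * t q * e.
  by rewrite /t obstruction_mod // rmorphM.
have t1 : t 1 = 1 by exact: in_qpoly1.
have tX (k : nat) : t ('qX ^+ k) * e = 'qX ^+ k * e.
  elim: k => [|k IH]; first by rewrite !expr0 t1.
  by rewrite exprS tM -mulrA IH mulrCA /t obstruction_mod // mulrCA mulrA -exprS.
case: a => k; first exact: tX.
apply: (mulrI (unitrX k.+1 (sector_unitX m))).
rewrite /exprz [RHS]mulrA divrr ?unitrX ?sector_unitX // mul1r.
rewrite -[in_qpoly _ _]/(t _) mulrCA -tX mulrCA mulrA -tM.
by rewrite divrr ?unitrX ?sector_unitX // t1 mul1r.
Qed.

Lemma vmul_linearl c f g h : vmul (c *: f + g) h = c *: vmul f h + vmul g h.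
Proof.
apply/ffunP=> m; rewrite !ffunE scaler_sumr -big_split; apply: eq_bigr => m1 _.
rewrite scaler_sumr -big_split; apply: eq_bigr => m2 _ /=.
rewrite !ffunE scalerAl -mulrDl -linearZ -rmorphD /=; congr (in_qpoly _ _ * _).
by rewrite mulrDl -scalerAl.
Qed.

Lemma vmul_linearr c f g h : vmul h (c *: f + g) = c *: vmul h f + vmul h g.
Proof.
apply/ffunP=> m; rewrite !ffunE scaler_sumr -big_split; apply: eq_bigr => m1 _.
rewrite scaler_sumr -big_split; apply: eq_bigr => m2 _ /=.
rewrite !ffunE scalerAl -mulrDl -linearZ -rmorphD /=; congr (in_qpoly _ _ * _).
by rewrite mulrDr -scalerAr.
Qed.

Lemma vmul_xmon m1 m2 (a1 a2 : int) :
  vmul (xmon F m1 a1) (xmon F m2 a2) =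
  [ffun m : 'I_n => if ((m1 + m2) %% n == m)%N
             then ('qX : sector F m) ^ (a1 + a2) * obstruction F m1 m2 m
             else 0 : sector F m].
Proof.
apply/ffunP=> m; rewrite !ffunE (bigD1 m1) //= addrC big1 ?add0r; last first.
  move=> i /negbTE i_m1; apply: big1 => j _.
  by rewrite ffunE i_m1 /= mul0r linear0 mul0r.
have out j : j != m2 ->
    in_qpoly (sector_rel F m) (polyn (xmon F m1 a1 m1) * polyn (xmon F m2 a2 j))
    * obstruction F m1 j m = 0.
  by move=> /negbTE j_m2; rewrite [xmon F m2 a2 j]ffunE j_m2 mulr0 linear0 mul0r.
case: eqP => [m12|m12]; last first.
  by apply: big1 => j /eqP m1j; apply: out; apply/eqP => jm2; rewrite -jm2 in m12.
rewrite (bigD1 m2) /= ?m12 // addrC big1 ?add0r; last first.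
  by move=> j /andP[_]; apply: out.
rewrite !ffunE !eqxx rmorphM /= -mulrA obstructionC.
rewrite obstruction_expX 1?addnC // obstructionC mulrCA obstruction_expX //.
by rewrite mulrA -exprzDr ?[a2 + a1]addrC //; exact: sector_unitX.
Qed.

Lemma xmon_gen f :
  f = \sum_(m < n) \sum_(i < size (f m : {poly F}))
        (f m : {poly F})`_i *: xmon F m i.
Proof.
have sumE (I : finType) (G : I -> inertiaK F n) m :
    (\sum_i G i) m = \sum_i G i m.
  by apply: (big_morph (fun h : inertiaK F n => h m)) => [h1 h2|]; rewrite ffunE.
apply/ffunP=> m; rewrite sumE (bigD1 m) //= addrC big1 ?add0r; last first.
  move=> m' /negbTE m'm; rewrite sumE big1 // => i _.
  by rewrite !ffunE eq_sym m'm scaler0.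
rewrite sumE -[LHS]in_qpolyK -[X in in_qpoly _ X]coefK poly_def linear_sum.
by apply: eq_bigr => i _; rewrite !ffunE eqxx linearZ /= rmorphXn.
Qed.

Lemma vadams_linear k : linear (@vadams F n k).
Proof.
move=> c f g; apply/ffunP=> m; rewrite !ffunE scalerAl -mulrDl.
by rewrite -linearZ -rmorphD /= comp_polyD comp_polyZ.
Qed.

Lemma sector_rel_comp m k : sector_rel F m %| sector_rel F m \Po 'X^k.
Proof.
have dvd1 (p : {poly F}) : p - 1 %| p ^+ k - 1 by rewrite subrX1 dvdp_mulr.
have Xn1 : ('X^n - 1 : {poly F}) %| ('X^n - 1) \Po 'X^k.
  by rewrite comp_polyB -polyC1 comp_polyC comp_Xn_poly polyC1 -exprM mulnC exprM dvd1.
rewrite /sector_rel; case: ifP => // _.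
by rewrite comp_polyM dvdp_mul // comp_polyB comp_polyX -polyC1 comp_polyC polyC1 dvd1.
Qed.

Lemma vadams_xmon k m (a : int) :
  vadams k (xmon F m a) =
  [ffun m' : 'I_n => if m' == m
     then ('qX : sector F m') ^ (k%:Z * a)
          * (if m' == 0%N :> nat then 1
             else \sum_(i < k) ('qX : sector F m') ^- i)
     else 0 : sector F m'].
Proof.
apply/ffunP=> m'; rewrite !ffunE; case: eqP => [m'm|_]; last first.
  by rewrite comp_poly0 linear0 mul0r.
congr (_ * _) => {m'm}.
pose t (p : sector F m') : sector F m' :=
  in_qpoly (sector_rel F m') ((p : {poly F}) \Po 'X^k).
have tE (p : {poly F}) :
    t (in_qpoly (sector_rel F m') p) = in_qpoly (sector_rel F m') (p \Po 'X^k).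
  apply/eqP; rewrite eq_sym -subr_eq0 -rmorphB -comp_polyB in_qpoly_eq0.
  have /dvdpP[q ->] := dvd_sub_in_qpoly m' p.
  by rewrite comp_polyM dvdp_mull // sector_rel_comp.
have tM p q : t (p * q) = t p * t q.
  by rewrite -[p * q]/(in_qpoly _ (polyn p * polyn q)) tE comp_polyM rmorphM.
have tX (j : nat) : t ('qX ^+ j) = ('qX ^+ k) ^+ j.
  elim: j => [|j IH]; last by rewrite !exprS tM IH tE comp_polyX rmorphXn.
  by rewrite !expr0 -in_qpoly1 tE comp_polyC.
rewrite -[LHS]/(t _) -exprz_exp; case: a => j; first exact: tX.
have uX : ('qX : sector F m') \is a GRing.unit by exact: sector_unitX.
apply: (mulrI (unitrX j.+1 (unitrX k uX))).
rewrite [RHS]divrr ?unitrX // -[in LHS]tX -tM.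
by rewrite [_ * _]divrr ?unitrX // (tX 0%N).
Qed.

End VirtualKTheoryCheck.

Definition spans (F : fieldType) (V : lmodType F) (P : V -> Prop) : Prop :=
  forall v : V, exists s : seq (F * V),
    (forall p, p \in s -> P p.2) /\ v = \sum_(p <- s) p.1 *: p.2.

(* Main.v *)
(** For e an n-th root of unity and a in Z/n put
      fourier e a f = \sum_m z^(a m) w_m(e) f_m(e),   w_0 = 1, w_m(e) = 1 - 1/e.
    The weights satisfy w_m1 w_m2 = w_(m1+m2) obstruction(m1, m2), so these functionals are
    characters of the virtual product, and psi^k acts on them by e |-> e^k.  At
    e = 1 all of them equal f_0(1); what they miss is the n-dimensional space of
    derivations at that point, with coordinates f_0'(1) and f_m(1) (m <> 0), on
    which psi^k acts by k.  Together these coordinates are injective.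
    For every alpha : Z/n -> nat and every tangent vector t there is hence a line
    element with coordinates fourier e a = e^(alpha a) and tangent t.  Varying
    alpha a at one a only, a discrete Fourier transform in alpha a shows that
    these elements span. *)
From HB Require Import structures.
Require Import Defs.
From mathcomp Require Import all_boot all_order all_algebra all_solvable all_field.
From mathcomp Require Import reals complex ring.

Set Implicit Arguments.
Unset Strict Implicit.
Unset Printing Implicit Defensive.

Import GRing.Theory.
Local Open Scope ring_scope.

Section LineElements.

Variables (F : fieldType) (n : nat) (z : F).
Hypothesis z_prim : n.-primitive_root z.
Implicit Types (m a b : 'I_n) (f g : inertiaK F n) (e : F).

Let n_gt0 : (0 < n)%N := prim_order_gt0 z_prim.

(** * Orthogonality of the characters of Z/n *)

Lemma sum_prim_root_expr i j : (i < n)%N -> (j < n)%N ->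
  \sum_(b < n) z ^+ (b * i) / z ^+ (b * j) = if i == j then n%:R else 0.
Proof.
move=> lt_in lt_jn; have zn0 : z != 0 by rewrite (prim_root_eq0 z_prim) -lt0n.
pose r := z ^+ i / z ^+ j.
have -> : \sum_(b < n) z ^+ (b * i) / z ^+ (b * j) = \sum_(b < n) r ^+ b.
  by apply: eq_bigr => b _; rewrite exprMn exprVn -!exprM ![(b * _)%N]mulnC.
case: eqP => [ij|/eqP ij].
  rewrite (eq_bigr (fun=> 1)) ?sumr_const ?card_ord // => b _.
  by rewrite /r ij divff ?expf_neq0 // expr1n.
have r_neq1 : r - 1 != 0.
  rewrite subr_eq0; apply: contra ij => /eqP r1.
  have : z ^+ i == z ^+ j.
    by rewrite -[z ^+ i](divfK (expf_neq0 j zn0)) -/r r1 mul1r.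
  by rewrite (eq_prim_root_expr z_prim) !modn_small.
(* The geometric sum times [r - 1] telescopes to [r ^+ n - 1], which is zero. *)
apply: (mulfI r_neq1); rewrite -subrX1 mulr0 exprMn exprVn -!exprM.
by rewrite ![(_ * n)%N]mulnC !exprM (prim_expr_order z_prim) !expr1n divr1 subrr.
Qed.

(** * Evaluation of a sector at an n-th root of unity *)

Section Evaluation.

Variables (e : F) (m : 'I_n).
Hypothesis e1 : e ^+ n = 1.
Implicit Types p q : sector F m.

(** Reduction changes [p] by a multiple of ['X^n - 1], which vanishes at [e]; so evaluation at [e]
    is well defined and multiplicative on the sector. *)
Lemma horner_in_qpoly (p : {poly F}) :
  (in_qpoly (sector_rel F m) p : {poly F}).[e] = p.[e].
Proof.
apply/eqP; rewrite eq_sym -subr_eq0 -hornerN -hornerD.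
have /dvdpP[q ->] := dvd_sub_in_qpoly n_gt0 m p.
by rewrite sector_relE !hornerM [X in _ * (_ * X)](_ : _ = 0) ?mulr0 // !hornerE e1 subrr.
Qed.

Lemma horner_sectorM p q :
  (p * q : sector F m).[e] = (p : {poly F}).[e] * (q : {poly F}).[e].
Proof. by rewrite -hornerM -[RHS]horner_in_qpoly. Qed.

Lemma horner_sector1 : (1 : sector F m).[e] = 1.
Proof. by rewrite -[1](in_qpoly1 (sector_rel F m)) horner_in_qpoly hornerC. Qed.

Lemma horner_sectorX : ('qX : sector F m).[e] = e.
Proof. by rewrite horner_in_qpoly hornerX. Qed.

Lemma horner_sectorXV : (('qX : sector F m)^-1 : sector F m).[e] = e^-1.
Proof.
have e0 : e != 0.
  by apply: contra_eq_neq e1 => ->; rewrite expr0n gtn_eqF //= eq_sym oner_eq0.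
apply: (mulfI e0); rewrite divff // -{1}horner_sectorX -horner_sectorM.
by rewrite divrr ?horner_sector1 // sector_unitX.
Qed.

Lemma horner_sector_exp p k : (p ^+ k : sector F m).[e] = (p : {poly F}).[e] ^+ k.
Proof.
by elim: k => [|k IH]; rewrite ?expr0 ?horner_sector1 // !exprS horner_sectorM IH.
Qed.

Lemma horner_sector_sum (I : Type) (r : seq I) (P : pred I) (G : I -> sector F m) :
  (\sum_(i <- r | P i) G i : sector F m).[e] = \sum_(i <- r | P i) (G i : {poly F}).[e].
Proof.
by apply: (big_morph (fun p : sector F m => (p : {poly F}).[e])) => [p q|];
  rewrite ?hornerD ?horner0.
Qed.

End Evaluation.

(** * The derivation at 1 on the untwisted sector *)

Section TangentAtOne.

Variable m : 'I_n.
Hypothesis m0 : m = 0%N :> nat.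
Implicit Types p q : sector F m.

(* The modulus of the untwisted sector has a double root at 1. *)
Lemma deriv_in_qpoly (p : {poly F}) :
  (in_qpoly (sector_rel F m) p : {poly F})^`().[1] = p^`().[1].
Proof.
apply/eqP; rewrite eq_sym -subr_eq0 -hornerN -hornerD -derivB.
have /dvdpP[q ->] := dvd_sub_in_qpoly n_gt0 m p.
by rewrite sector_relE m0 /= !derivE !hornerE expr1n /= subrr !(mulr0, mul0r, addr0).
Qed.

Lemma deriv_sectorM p q : ((p * q : sector F m) : {poly F})^`().[1] =
  (p : {poly F})^`().[1] * (q : {poly F}).[1] + (p : {poly F}).[1] * (q : {poly F})^`().[1].
Proof. by rewrite -!hornerM -hornerD -derivM -[RHS]deriv_in_qpoly. Qed.

Lemma deriv_sector1 : ((1 : sector F m) : {poly F})^`().[1] = 0.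
Proof. by rewrite -[1](in_qpoly1 (sector_rel F m)) deriv_in_qpoly derivC horner0. Qed.

Lemma deriv_sector_sum (I : Type) (r : seq I) (P : pred I) (G : I -> sector F m) :
  ((\sum_(i <- r | P i) G i : sector F m) : {poly F})^`().[1] =
  \sum_(i <- r | P i) (G i : {poly F})^`().[1].
Proof.
by apply: (big_morph (fun p : sector F m => (p : {poly F})^`().[1])) => [p q|];
  rewrite ?derivD ?hornerD ?deriv0 ?horner0.
Qed.

End TangentAtOne.

(** * Fourier and tangent coordinates and their joint injectivity *)

Definition weight m e : F := if m == 0%N :> nat then 1 else 1 - e^-1.

Definition fourier e a f : F :=
  \sum_(m < n) z ^+ (a * m) * (weight m e * (f m : {poly F}).[e]).

(** The datum at 1 that [fourier] misses: in a twisted sector the weight kills the value at 1; in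
    the untwisted one that value is seen, but not the derivative at the double root. *)
Definition jet m (p : {poly F}) : F := if m == 0%N :> nat then p^`().[1] else p.[1].

Lemma jet_in_qpoly m (p : {poly F}) : jet m (in_qpoly (sector_rel F m) p) = jet m p.
Proof.
rewrite /jet; case: eqP => m0; first by rewrite deriv_in_qpoly.
by rewrite horner_in_qpoly // expr1n.
Qed.

Lemma jetDZ m c (p q : {poly F}) : jet m (c *: p + q) = c * jet m p + jet m q.
Proof. by rewrite /jet; case: ifP => _; rewrite ?derivD ?derivZ hornerD hornerZ. Qed.

Definition tangent m f : F := jet m (f m).

Fact fourier_is_linear e a : linear (fourier e a : inertiaK F n -> F^o).
Proof.
move=> c f g; rewrite /fourier scaler_sumr -big_split; apply: eq_bigr => m _ /=.
by rewrite !ffunE hornerD hornerZ /GRing.scale /=; ring.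
Qed.
HB.instance Definition _ e a :=
  GRing.isLinear.Build F (inertiaK F n) F^o _ (fourier e a) (fourier_is_linear e a).

Fact tangent_is_linear m : linear (tangent m : inertiaK F n -> F^o).
Proof.
by move=> c f g; rewrite /tangent !ffunE jetDZ. Qed.
HB.instance Definition _ m :=
  GRing.isLinear.Build F (inertiaK F n) F^o _ (tangent m) (tangent_is_linear m).

Lemma fourierZ e a c (f : (inertiaK F n : lmodType F)) : fourier e a (c *: f) = c * fourier e a f.
Proof. by rewrite linearZ. Qed.

Lemma tangentZ m c (f : (inertiaK F n : lmodType F)) : tangent m (c *: f) = c * tangent m f.
Proof. by rewrite linearZ. Qed.

Lemma fourier_inv e f m :
  \sum_(a < n) fourier e a f / z ^+ (a * m) = n%:R * (weight m e * (f m : {poly F}).[e]).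
Proof.
under eq_bigr => a _ do rewrite mulr_suml.
rewrite exchange_big (bigD1 m) //= addrC big1 ?add0r => [|m' m'm].
  under eq_bigr => a _ do rewrite mulrAC.
  by rewrite -mulr_suml sum_prim_root_expr // eqxx.
under eq_bigr => a _ do rewrite mulrAC.
by rewrite -mulr_suml sum_prim_root_expr // ifN ?mul0r.
Qed.

Lemma Xn_sub_1_dvd (p : {poly F}) :
  (forall e, e ^+ n = 1 -> p.[e] = 0) -> 'X^n - 1 %| p.
Proof.
move=> p0; rewrite -(factor_Xn_sub_1 z_prim) /index_iota subn0.
rewrite -(big_map (fun i => z ^+ i) xpredT (fun x => 'X - x%:P)).
apply: uniq_roots_dvdp.
  apply/allP => _ /mapP[i _ ->]; rewrite /root p0 //.
  by rewrite -exprM mulnC exprM (prim_expr_order z_prim) expr1n.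
rewrite uniq_rootsE map_inj_in_uniq ?iota_uniq // => i j.
rewrite !mem_iota /= add0n => lt_in lt_jn /eqP.
by rewrite (eq_prim_root_expr z_prim) !modn_small // => /eqP.
Qed.

(** Fourier inversion recovers the weighted values of each component. A twisted weight vanishes only
    at [e = 1], where the tangent supplies the missing value; in the untwisted sector the tangent
    supplies the second factor ['X - 1]. *)
Lemma coordinates_eq0 f :
    (forall e a, e ^+ n = 1 -> fourier e a f = 0) -> (forall m, tangent m f = 0) ->
  f = 0.
Proof.
move=> f0 t0; have nF := prim_root_natf_neq0 z_prim.
have w0 m e : e ^+ n = 1 -> weight m e * (f m : {poly F}).[e] = 0.
  move=> e1; apply: (mulfI nF); rewrite -fourier_inv mulr0 big1 // => a _.
  by rewrite f0 // mul0r.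
apply/ffunP => m; rewrite ffunE -[LHS]in_qpolyK //; apply/eqP; rewrite in_qpoly_eq0 //.
have := t0 m; have := w0 m; rewrite /tangent /jet; move: (polyn (f m)) => p {}w0.
rewrite sector_relE; case: eqP => m0 tm0.
  have /dvdpP[q pE] : 'X^n - 1 %| p.
    by apply: Xn_sub_1_dvd => e /(w0 e); rewrite /weight m0 eqxx mul1r.
  (* The derivative of [q * ('X^n - 1)] at 1 is n q(1), so the zero tangent forces q(1) = 0. *)
  rewrite pE dvdp_mul ?dvdpp // -polyC1 dvdp_XsubCl /root.
  move/eqP: tm0; rewrite pE !derivE !hornerE !expr1n subrr mulr0 add0r subr0.
  by rewrite hornerMn hornerXn expr1n mulf_eq0 (negbTE nF) orbF.
rewrite mul1r; apply: Xn_sub_1_dvd => e /[dup] e1 /(w0 e) /eqP.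
rewrite /weight; have [-> _|e_neq1] := eqVneq e 1; first exact: tm0.
rewrite ifN; last exact/eqP.
by rewrite mulf_eq0 subr_eq0 eq_sym invr_eq1 (negbTE e_neq1) => /eqP.
Qed.

Lemma coordinates_inj f g :
    (forall e a, e ^+ n = 1 -> fourier e a f = fourier e a g) ->
    (forall m, tangent m f = tangent m g) ->
  f = g.
Proof.
move=> fg tfg; apply/eqP; rewrite -subr_eq0; apply/eqP/coordinates_eq0 => [e a e1|m].
  by rewrite linearB /= fg ?subrr.
by rewrite linearB /= tfg subrr.
Qed.

(** * The virtual product in coordinates *)

Lemma addn_ord_modn0 m1 m2 :
  ((m1 + m2) %% n)%N = 0%N -> m1 != 0%N :> nat -> (m1 + m2)%N = n.
Proof.
move=> /eqP /dvdnP[[|[|k]] E] m10.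
- by move/eqP: E; rewrite mul0n addn_eq0 (negbTE m10).
- by rewrite E mul1n.
have : (m1 + m2 < n + n)%N by rewrite -addnS leq_add // ltnW.
by rewrite E addnn -mul2n ltn_mul2r ltnS ltnS ltn0 andbF.
Qed.

Lemma horner_obstruction m1 m2 m e : e ^+ n = 1 -> ((m1 + m2) %% n)%N = m ->
  weight m e * (obstruction F m1 m2 m : {poly F}).[e] = weight m1 e * weight m2 e.
Proof.
move=> e1 m12; rewrite /obstruction /weight -m12.
have oV : (1 - ('qX : sector F m)^-1 : sector F m).[e] = 1 - e^-1.
  by rewrite hornerD hornerN horner_sector1 // horner_sectorXV.
have [m10|m10] := eqVneq (m1 : nat) 0%N.
  by rewrite m10 add0n modn_small ?ltn_ord //= horner_sector1 // mulr1 mul1r.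
have [m20|m20] := eqVneq (m2 : nat) 0%N.
  by rewrite m20 addn0 modn_small ?ltn_ord //= (negbTE m10) horner_sector1.
have [->|m12n] := eqVneq (m1 + m2)%N n.
  by rewrite modnn mul1r -expr2 -oV -horner_sector_exp.
rewrite ifN ?oV //=; apply: contra m12n => /eqP m12_0.
by rewrite (addn_ord_modn0 m12_0).
Qed.

(** Both z^(a m) and, up to the obstruction, the weight are multiplicative in the sector index; what
    remains is to regroup the pairs (m1, m2) by their sum mod n. *)
Lemma fourierM e a f g : e ^+ n = 1 ->
  fourier e a (vmul f g) = fourier e a f * fourier e a g.
Proof.
move=> e1; rewrite /fourier mulr_suml.
transitivity (\sum_(m < n) \sum_(m1 < n) \sum_(m2 < n | ((m1 + m2) %% n == m)%N)
   (z ^+ (a * m1) * (weight m1 e * (f m1 : {poly F}).[e])) *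
   (z ^+ (a * m2) * (weight m2 e * (g m2 : {poly F}).[e]))).
  apply: eq_bigr => m _; rewrite ffunE horner_sector_sum !mulr_sumr.
  apply: eq_bigr => m1 _; rewrite horner_sector_sum !mulr_sumr.
  apply: eq_bigr => m2 /eqP m12.
  rewrite horner_sectorM // horner_in_qpoly // hornerM.
  have -> : z ^+ (a * m) = z ^+ (a * m1) * z ^+ (a * m2).
    apply/eqP; rewrite -exprD -mulnDr (eq_prim_root_expr z_prim) -m12.
    by rewrite modnMmr.
  by rewrite [weight m e * _]mulrCA horner_obstruction //; ring.
rewrite exchange_big; apply: eq_bigr => m1 _; rewrite mulr_sumr.
rewrite (exchange_big_dep xpredT) //=; apply: eq_bigr => m2 _.
by rewrite (big_pred1 (Ordinal (ltn_pmod (m1 + m2) n_gt0))).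
Qed.

(** All twisted weights vanish at [e = 1], so the value there does not depend on [a]. *)
Lemma fourier1 a f m : m = 0%N :> nat -> fourier 1 a f = (f m : {poly F}).[1].
Proof.
move=> m0; rewrite /fourier (bigD1 m) //= addrC big1 ?add0r => [|m' m'm].
  by rewrite /weight m0 muln0 expr0 eqxx !mul1r.
by rewrite /weight -m0 [_ == _ :> nat](negbTE m'm) invr1 subrr mul0r mulr0.
Qed.

(** Leibniz rule: products of two twisted sectors contribute nothing, so at least one factor is
    untwisted, and there the obstruction is 1. *)
Lemma tangentM a m f g :
  tangent m (vmul f g) = tangent m f * fourier 1 a g + fourier 1 a f * tangent m g.
Proof.
have e1 : 1 ^+ n = 1 :> F by rewrite expr1n.
pose o : 'I_n := Ordinal n_gt0.
have oV : (1 - ('qX : sector F m)^-1 : sector F m).[1] = 0.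
  by rewrite hornerD hornerN horner_sector1 // horner_sectorXV // invr1 subrr.
rewrite !(@fourier1 a _ o) // /tangent /jet ffunE; have [m0|m0] := eqVneq (m : nat) 0%N.
  have -> : o = m by apply: val_inj.
  rewrite deriv_sector_sum // (bigD1 m) //= addrC big1 ?add0r => [|m1 m1m].
    rewrite deriv_sector_sum // (big_pred1 m) => [|m2]; last first.
      by rewrite /= m0 add0n modn_small // -m0.
    rewrite /obstruction m0 eqxx mulr1.
    exact: deriv_sectorM.
  (* Two twisted sectors with untwisted sum: the obstruction is a square vanishing to second order
     at 1, so its derivative vanishes too. *)
  rewrite deriv_sector_sum // big1 // => m2 /eqP m12.
  have m10 : (m1 == 0%N :> nat) = false by rewrite -m0; exact: negbTE m1m.
  have m20 : (m2 == 0%N :> nat) = false.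
    by apply: contra_eqF m12 => /eqP ->; rewrite addn0 modn_small // m0 m10.
  have m12n : (m1 + m2)%N = n by rewrite addn_ord_modn0 ?m10 // m12 m0.
  rewrite deriv_sectorM // /obstruction m10 m20 m12n eqxx.
  by rewrite expr2 horner_sectorM // deriv_sectorM // oV !(mulr0, mul0r, addr0).
rewrite horner_sector_sum (bigD1 o) // (bigD1 m) //.
rewrite [\big[_/_]_(_ < n | (_ && _) && _) _]big1 => [|m1].
  rewrite Monoid.mulm1 [LHS]addrC; congr (_ + _).
    rewrite horner_sector_sum (big_pred1 o) => [|m2]; last first.
      rewrite -[X in _ == X](modn_small (ltn_ord m)) -[X in _ == X %[mod _]]addn0.
      by rewrite eqn_modDl !modn_small.
    by rewrite /obstruction orbT mulr1 horner_in_qpoly // hornerM.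
  rewrite horner_sector_sum (big_pred1 m) => [|m2]; last first.
    by rewrite add0n modn_small.
  by rewrite /obstruction mulr1 horner_in_qpoly // hornerM.
(* Two twisted sectors with twisted sum: a simple zero of the obstruction at 1 suffices, as only the
   value is taken. *)
move=> /andP[m1o m1m]; rewrite horner_sector_sum big1 // => m2 /eqP m12.
have m10 : (m1 == 0%N :> nat) = false := negbTE m1o.
have m20 : (m2 == 0%N :> nat) = false.
  apply: contraNF m1m => /eqP m20.
  by apply/eqP/val_inj; rewrite /= -m12 m20 addn0 modn_small.
have m12n : (m1 + m2 == n)%N = false.
  by apply: contraNF m0 => /eqP m12n; rewrite -m12 m12n modnn.
by rewrite horner_sectorM // /obstruction m10 m20 m12n oV mulr0.
Qed.

(** * Elements with prescribed coordinates *)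

(* Solves fourier e a = e ^+ al a by Fourier inversion in a; for m <> 0 the sum of
   the z ^- (b m) over b vanishes, so e ^+ al b may be replaced by e ^+ al b - 1,
   whose quotient by the weight 1 - e^-1 is a polynomial in e. *)
Definition line_poly (al : 'I_n -> nat) m : {poly F} :=
  n%:R^-1 *: \sum_(b < n) (z ^+ (b * m))^-1 *:
    (if m == 0%N :> nat then 'X^(al b) else 'X * \sum_(i < al b) 'X^i).

(* Invisible to the Fourier coordinates; used to adjust the tangent coordinates. *)
Definition null_poly m : {poly F} :=
  if m == 0%N :> nat then 'X^n - 1 else \sum_(i < n) 'X^i.

Definition line (al : 'I_n -> nat) (t : 'I_n -> F) : inertiaK F n :=
  [ffun m : 'I_n => in_qpoly (sector_rel F m)
     (line_poly al m + ((t m - jet m (line_poly al m)) / n%:R) *: null_poly m)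
   : sector F m].

Lemma tangent_line al t m : tangent m (line al t) = t m.
Proof.
have nF := prim_root_natf_neq0 z_prim.
(* This is why [line] divides the correction by n: n is the derivative of ['X^n - 1] at 1, and also
   the value there of a sum of n powers. *)
have jN : jet m (null_poly m) = n%:R.
  rewrite /jet /null_poly; case: eqP => _.
    by rewrite !derivE !hornerE hornerMn hornerXn expr1n subr0.
  rewrite horner_sum (eq_bigr (fun=> 1)) ?sumr_const ?card_ord // => i _.
  by rewrite hornerXn expr1n.
by rewrite /tangent ffunE jet_in_qpoly addrC jetDZ jN divfK // subrK.
Qed.

Lemma fourier_line al t e a : e ^+ n = 1 -> fourier e a (line al t) = e ^+ al a.
Proof.
move=> e1; have nF := prim_root_natf_neq0 z_prim.
have e0 : e != 0.
  by apply: contra_eq_neq e1 => ->; rewrite expr0n gtn_eqF //= eq_sym oner_eq0.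
have geo k : (1 - e^-1) * (e * \sum_(i < k) e ^+ i) = e ^+ k - 1.
  by rewrite subrX1 mulrA [_ * e]mulrBl mul1r mulVf.
have N0 m : weight m e * (null_poly m).[e] = 0.
  rewrite /weight /null_poly; case: eqP => _.
    by rewrite !hornerE e1 subrr.
  apply: (mulfI e0); rewrite horner_sum mulr0.
  under eq_bigr => i _ do rewrite hornerXn.
  by rewrite mulrCA geo e1 subrr.
have w m : weight m e * (line al t m : {poly F}).[e] =
    n%:R^-1 * \sum_(b < n) e ^+ al b / z ^+ (b * m).
  rewrite ffunE horner_in_qpoly // hornerD mulrDr [(_ *: null_poly m).[e]]hornerZ [X in _ + X]mulrCA N0 mulr0 addr0.
  rewrite hornerZ mulrCA horner_sum mulr_sumr; congr (_ * _).
  rewrite /weight; have [m0|m0] := eqVneq (m : nat) 0%N.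
    by apply: eq_bigr => b _; rewrite hornerZ hornerXn mul1r mulrC.
  (* The subtracted sum is zero by orthogonality, as m is nonzero; thus twisted and untwisted
     sectors obey the same formula. *)
  transitivity (\sum_(b < n) e ^+ al b / z ^+ (b * m) -
                \sum_(b < n) z ^+ (b * 0) / z ^+ (b * m)).
    rewrite -sumrB; apply: eq_bigr => b _.
    rewrite hornerZ hornerM hornerX horner_sum mulrCA.
    under [X in e * X]eq_bigr => i _ do rewrite hornerXn.
    by rewrite geo muln0 expr0 mulrBr mulr1 mul1r mulrC.
  by rewrite sum_prim_root_expr // eq_sym (negbTE m0) subr0.
rewrite /fourier.
transitivity (n%:R^-1 * \sum_(b < n) e ^+ al b *
    \sum_(m < n) z ^+ (m * a) / z ^+ (m * b)).
  under eq_bigr => m _ do rewrite w mulrCA mulr_sumr.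
  rewrite -mulr_sumr exchange_big; congr (_ * _); apply: eq_bigr => b _.
  by rewrite mulr_sumr; apply: eq_bigr => m _; rewrite ![(m * _)%N]mulnC mulrCA.
under eq_bigr => b _ do rewrite sum_prim_root_expr //.
rewrite (bigD1 a) //= eqxx big1 => [|b b_a].
  by rewrite addr0 mulrCA mulVf ?mulr1.
by rewrite eq_sym [_ == _](negbTE b_a) mulr0.
Qed.

(** * Unit, powers and Adams operations in coordinates *)

Lemma fourier_vone e a : e ^+ n = 1 -> fourier e a (vone F n) = 1.
Proof.
move=> e1; rewrite /fourier (bigD1 (Ordinal n_gt0)) //= addrC big1 ?add0r => [|m m0].
  by rewrite muln0 expr0 ffunE /= horner_sector1 // !mulr1.
by rewrite ffunE [_ == _ :> nat](negbTE m0) horner0 !mulr0.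
Qed.

Lemma tangent_vone m : tangent m (vone F n) = 0.
Proof.
rewrite /tangent /jet ffunE; case: eqP => m0; last by rewrite horner0.
by rewrite deriv_sector1.
Qed.

Lemma fourier_vexp e a f k : e ^+ n = 1 -> fourier e a (vexp f k) = fourier e a f ^+ k.
Proof.
move=> e1; elim: k => [|k IH]; first by rewrite fourier_vone.
by rewrite [vexp _ _]/= fourierM // IH exprS.
Qed.

Lemma tangent_vexp m f k : (forall a, fourier 1 a f = 1) ->
  tangent m (vexp f k) = k%:R * tangent m f.
Proof.
move=> f1; elim: k => [|k IH]; first by rewrite tangent_vone mul0r.
rewrite [vexp _ _]/= (tangentM m) f1 fourier_vexp ?expr1n // f1 expr1n IH.
by rewrite mulr1 mul1r mulrS mulrDl mul1r.
Qed.

(** In a twisted sector the Adams factor turns the weight 1 - 1/e into 1 - 1/e^k by telescoping,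
    which is the weight at e^k. *)
Lemma fourier_vadams e a f k : e ^+ n = 1 ->
  fourier e a (vadams k f) = fourier (e ^+ k) a f.
Proof.
move=> e1; apply: eq_bigr => m _; congr (_ * _).
rewrite ffunE horner_sectorM // horner_in_qpoly // horner_comp hornerXn mulrCA mulrC.
congr (_ * _); rewrite /weight; case: eqP => m0; first by rewrite horner_sector1 // mulr1.
rewrite horner_sector_sum.
have -> : \sum_(i < k) (('qX : sector F m) ^- i : sector F m).[e] = \sum_(i < k) e^-1 ^+ i.
  by apply: eq_bigr => i _; rewrite -exprVn horner_sector_exp // horner_sectorXV.
by rewrite -[LHS]opprK -mulNr opprB -subrX1 opprB exprVn.
Qed.

(** The factor k comes from the chain rule in the untwisted sector, and from the k summands equal to
    1 at [e = 1] in a twisted one. *)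
Lemma tangent_vadams m f k : tangent m (vadams k f) = k%:R * tangent m f.
Proof.
have e1 : 1 ^+ n = 1 :> F by rewrite expr1n.
rewrite /tangent /jet ffunE; case: eqP => m0.
  rewrite mulr1 deriv_in_qpoly // deriv_comp hornerM horner_comp hornerXn expr1n.
  by rewrite derivXn hornerMn hornerXn expr1n mulrC.
rewrite horner_sectorM // horner_in_qpoly // horner_comp hornerXn expr1n mulrC.
congr (_ * _); rewrite horner_sector_sum (eq_bigr (fun=> 1)) ?sumr_const ?card_ord // => i _.
by rewrite -exprVn horner_sector_exp // horner_sectorXV // invr1 expr1n.
Qed.

(** * Line elements and their span *)

Lemma virtual_line_element_line al t : virtual_line_element (line al t).
Proof.
have e1 : 1 ^+ n = 1 :> F by rewrite expr1n.
have line1 a be u : fourier 1 a (line be u) = 1 by rewrite fourier_line // expr1n.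
split=> [|k k_gt0].
  have lineV be ga u v : (forall a e, e ^+ n = 1 -> e ^+ be a * e ^+ ga a = 1) ->
      (forall m, u m + v m = 0) -> vmul (line be u) (line ga v) = vone F n.
    move=> bg uv; apply: coordinates_inj => [e a e_1|m].
      by rewrite fourierM // !fourier_line // bg // fourier_vone.
    by rewrite (tangentM m) !line1 !tangent_line mulr1 mul1r uv tangent_vone.
  have alV a e : e ^+ n = 1 -> e ^+ al a * e ^+ (n.-1 * al a) = 1.
    by move=> e_1; rewrite -exprD -mulSn prednK // exprM e_1 expr1n.
  (* Since e^n = 1, the exponent n - 1 inverts e while staying in nat. *)
  exists (line (fun a => n.-1 * al a)%N (fun m => - t m)).
  split; apply: lineV => [a e|m]; rewrite ?subrr ?addNr //; first exact: alV.
  by rewrite mulrC; exact: alV.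
apply: coordinates_inj => [e a e_1|m].
  have ek1 : (e ^+ k) ^+ n = 1 by rewrite -exprM mulnC exprM e_1 expr1n.
  by rewrite fourier_vadams // fourier_vexp // !fourier_line // -!exprM mulnC.
by rewrite tangent_vadams tangent_vexp.
Qed.

Lemma spans_line_elements : spans (fun L : inertiaK F n => virtual_line_element L).
Proof.
move=> f; have nF := prim_root_natf_neq0 z_prim; pose o : 'I_n := Ordinal n_gt0.
(* [c (a, b)] are the discrete Fourier coefficients of e |-> [fourier e a f], so that this function
   is the sum of the c(a, b) e^b. *)
pose c (p : 'I_n * 'I_n) : F :=
  n%:R^-1 * \sum_(j < n) fourier (z ^+ j) p.1 f / z ^+ (p.2 * j).
pose al (p : 'I_n * 'I_n) a : nat := if a == p.1 then p.2 : nat else 0%N.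
pose L p := line (al p) (fun=> 0).
pose L0 := line (fun=> 0%N) (fun=> 0).
pose L1 := line (fun=> 0%N) (fun m => tangent m f).
have sum_c a (j : 'I_n) : \sum_(b < n) c (a, b) * (z ^+ j) ^+ b = fourier (z ^+ j) a f.
  transitivity (n%:R^-1 * \sum_(i < n) fourier (z ^+ i) a f *
      \sum_(b < n) z ^+ (b * j) / z ^+ (b * i)).
    under eq_bigr => b _ do rewrite -mulrA mulr_suml.
    rewrite -mulr_sumr exchange_big; congr (_ * _); apply: eq_bigr => i _.
    rewrite mulr_sumr; apply: eq_bigr => b _.
    by rewrite -exprM [(j * b)%N]mulnC mulrAC mulrA.
  under eq_bigr => i _ do rewrite sum_prim_root_expr //.
  rewrite (bigD1 j) //= eqxx big1 => [|i i_j].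
    by rewrite addr0 mulrCA mulVf ?mulr1.
  by rewrite eq_sym [_ == _](negbTE i_j) mulr0.
(* [L1] alone carries the tangent of [f]. The coefficient of [L0], all of whose Fourier coordinates
   are 1, cancels the 1 from [L1] and the total of the [c p], and restores the common value at
   [e = 1]. *)
exists [:: (fourier 1 o f - 1 - \sum_p c p, L0), (1, L1)
         & [seq (c p, L p) | p <- index_enum ('I_n * 'I_n)%type]].
split=> [q|].
  by rewrite !inE => /or3P[/eqP->|/eqP->|/mapP[p _ ->]]; exact: virtual_line_element_line.
rewrite !big_cons big_map /= scale1r.
apply: coordinates_inj => [e a e1|m].
  have [j ->] := prim_rootP z_prim e1.
  have zj1 : (z ^+ j) ^+ n = 1 by rewrite exprAC (prim_expr_order z_prim) expr1n.
  rewrite !linearD linear_sum /= fourierZ !fourier_line // expr0 mulr1.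
  (* With the constant [c p] split off, only the terms with [p.1 = a] survive. *)
  rewrite [X in _ + (_ + X)](eq_bigr (fun p => c p + c p * ((z ^+ j) ^+ al p a - 1))) => [|p _]; last first.
    by rewrite fourierZ fourier_line // mulrBr mulr1 addrC subrK.
  rewrite big_split /= -(pair_bigA _ (fun a' b => c (a', b) * ((z ^+ j) ^+ al (a', b) a - 1))).
  rewrite (bigD1 a) //= [X in _ + (_ + (_ + (_ + X)))]big1 => [|a' a'a]; last first.
    by apply: big1 => b _; rewrite /al eq_sym (negbTE a'a) subrr mulr0.
  have -> : \sum_(b < n) c (a, b) * ((z ^+ j) ^+ al (a, b) a - 1) =
      fourier (z ^+ j) a f - \sum_(b < n) c (a, b).
    rewrite -sum_c -sumrB; apply: eq_bigr => b _.
    by rewrite /al eqxx mulrBr mulr1.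
  have -> : \sum_(b < n) c (a, b) = fourier 1 o f.
    rewrite (@fourier1 o _ o) // -(@fourier1 a) //; have := sum_c a o; rewrite expr0 => <-.
    by apply: eq_bigr => b _; rewrite expr1n mulr1.
  ring.
rewrite !linearD linear_sum /= tangentZ !tangent_line mulr0 add0r.
by rewrite big1 ?addr0 // => p _; rewrite tangentZ tangent_line mulr0.
Qed.

End LineElements.

(** * Primitive roots of unity in a closed field *)

Lemma closed_field_prim_root (F : closedFieldType) (n : nat) :
  n%:R != 0 :> F -> exists z : F, n.-primitive_root z.
Proof.
move=> nF; have n_gt0 : (0 < n)%N by rewrite lt0n; apply: contraNneq nF => ->.
have [r rE] := closed_field_poly_normal ('X^n - 1 : {poly F}).
have := separable_Xn_sub_1 nF; rewrite {1}rE lead_coefXnsubC // scale1r.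
rewrite separable_prod_XsubC => r_uniq.
have size_r : (n <= size r)%N.
  have := congr1 (size \o polyseq) rE; rewrite /= lead_coefXnsubC // scale1r.
  by rewrite size_XnsubC // size_prod_XsubC => -[->].
have r_root : all n.-unity_root r.
  apply/allP => x xr; rewrite /root_of_unity rE lead_coefXnsubC // scale1r.
  by rewrite root_prod_XsubC.
(* By separability [r] lists n distinct n-th roots of unity, and a finite group of units of a field
   is cyclic. *)
by have /hasP[z _ z_prim] := has_prim_root n_gt0 r_root r_uniq size_r; exists z.
Qed.

Theorem proposition7p2 (R : realType) (n : nat) (hn : (2 <= n)%N) :
  spans (fun L : inertiaK R[i]%C n => virtual_line_element L).
Proof.
have nF : n%:R != 0 :> R[i]%C by rewrite Num.Theory.pnatr_eq0 -lt0n ltnW.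
have [z z_prim] := closed_field_prim_root nF.
exact: spans_line_elements z_prim.
Qed.
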